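(* Let $u(x,y,t)=x-3yt-2x^3$ on $\mathbb{H}^1$, let $\alpha_1,\alpha_2>0$, and let $u_{\alpha_1,\alpha_2}=\alpha_1u^+-\alpha_2u^-$. Then the function $$J_{u_{\alpha_1,\alpha_2}}^{\mathbb{H}^1}(r)=\frac{1}{r^4}\left(\int_{B_r^{\mathbb{H}^1}(0)}\frac{|\nabla_{\mathbb{H}^1}(\alpha_1u^+)(\xi)|^2}{|\xi|_{\mathbb{H}^1}^2}\,d\xi\right)\left(\int_{B_r^{\mathbb{H}^1}(0)}\frac{|\nabla_{\mathbb{H}^1}(\alpha_2u^-)(\xi)|^2}{|\xi|_{\mathbb{H}^1}^2}\,d\xi\right),\qquad r>0,$$ is monotone decreasing in a right neighborhood of $r=0$, i.e. on $(0,r_0)$ for some $r_0>0$.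
   Context: $\mathbb{H}^1$ is the first Heisenberg group: $\mathbb{R}^3$ with points $\xi=(x,y,t)$ and group law $(x_1,y_1,t_1)\circ(x_2,y_2,t_2)=(x_1+x_2,y_1+y_2,t_1+t_2+2(x_2y_1-x_1y_2))$. The vector fields are $X=\partial_x+2y\,\partial_t$ and $Y=\partial_y-2x\,\partial_t$; the horizontal gradient is $\nabla_{\mathbb{H}^1}u=(Xu,Yu)$ with $|\nabla_{\mathbb{H}^1}u|^2=(Xu)^2+(Yu)^2$. The Koranyi norm is $|(x,y,t)|_{\mathbb{H}^1}=((x^2+y^2)^2+t^2)^{1/4}$ and $B_r^{\mathbb{H}^1}(0)=\{\xi:|\xi|_{\mathbb{H}^1}<r\}$. $d\xi$ is Lebesgue measure on $\mathbb{R}^3$. $u^+=\sup\{u,0\}$ and $u^-=\sup\{-u,0\}$; horizontal gradients of $u^\pm$ are understood almost everywhere. Note that $\alpha_1u^+$ and $\alpha_2u^-$ are the positive and negative parts of $u_{\alpha_1,\alpha_2}$. *)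

(* Defs.v *)
From HB Require Import structures.
From mathcomp Require Import all_boot all_order all_algebra.
From mathcomp Require Import all_classical all_reals all_analysis.
Set Implicit Arguments.
Unset Strict Implicit.
Unset Printing Implicit Defensive.
Import Order.TTheory GRing.Theory Num.Theory.
Import numFieldNormedType.Exports.
Local Open Scope classical_set_scope.
Local Open Scope ring_scope.

(* The Heisenberg group H^1: a point (x, y, t) is the pair ((x, y), t). *)
Definition heis (R : realType) : Type := (R * R * R)%type.

Section Heisenberg.
Variable R : realType.
Implicit Types (f v : heis R -> R) (p : heis R) (r : R).

Definition xcoord p : R := p.1.1.
Definition ycoord p : R := p.1.2.
Definition tcoord p : R := p.2.

(* The directional derivative 'D_w is total. Where it does not exist its value
   is unspecified; for the positive and negative parts of a polynomial this
   concerns only a Lebesgue-null set. *)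
Definition partial_x f p : R := 'D_((1, 0, 0) : R * R * R) (f : R * R * R -> R) p.
Definition partial_y f p : R := 'D_((0, 1, 0) : R * R * R) (f : R * R * R -> R) p.
Definition partial_t f p : R := 'D_((0, 0, 1) : R * R * R) (f : R * R * R -> R) p.

Definition heisX f p : R := partial_x f p + 2 * ycoord p * partial_t f p.
Definition heisY f p : R := partial_y f p - 2 * xcoord p * partial_t f p.

Definition hgrad f p : R * R := (heisX f p, heisY f p).

(* The library norm on R * R is the sup norm, so the squared Euclidean length
   of the horizontal gradient is written out. *)
Definition hgrad_sq f p : R := (hgrad f p).1 ^+ 2 + (hgrad f p).2 ^+ 2.

Definition koranyi p : R :=
  ((xcoord p ^+ 2 + ycoord p ^+ 2) ^+ 2 + tcoord p ^+ 2) `^ (4^-1).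

Definition kball r : set (heis R) := [set p | koranyi p < r].

Definition heis_measure :=
  ((@lebesgue_measure R \x @lebesgue_measure R) \x @lebesgue_measure R)%E.

HB.instance Definition _ := Measure.on heis_measure.

(* At the origin the quotient is 0 since 0^-1 = 0; the origin is a null set. *)
Definition acf_energy f r : \bar R :=
  (\int[heis_measure]_(p in kball r) (hgrad_sq f p / koranyi p ^+ 2)%:E)%E.

(* J_v^{H^1}(r) is meaningful for r > 0. *)
Definition acf v r : \bar R :=
  ((r ^- 4)%:E * acf_energy (v^\+)%R r * acf_energy (v^\-)%R r)%E.

Definition two_phase (a1 a2 : R) v p : R := a1 * v^\+ p - a2 * v^\- p.

Definition heis_u p : R :=
  xcoord p - 3 * ycoord p * tcoord p - 2 * xcoord p ^+ 3.

Lemma two_phase_pos (a1 a2 : R) v : 0 < a1 -> 0 < a2 ->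
  (two_phase a1 a2 v)^\+ = (fun p => a1 * v^\+ p).
Proof.
move=> a1_gt0 a2_gt0; apply/funext => p; rewrite /two_phase /funrpos /funrneg.
have [v0|/ltW v0] := leP 0 (v p).
- have Nv0 : - v p <= 0 by rewrite oppr_le0.
  have av0 : 0 <= a1 * v p by rewrite mulr_ge0// ltW.
  by rewrite (max_idPr Nv0) mulr0 subr0 (max_idPl av0).
- have Nv0 : 0 <= - v p by rewrite oppr_ge0.
  have av0 : a2 * v p <= 0 by rewrite mulr_ge0_le0// ltW.
  by rewrite (max_idPl Nv0) mulr0 sub0r mulrN opprK (max_idPr av0).
Qed.

Lemma two_phase_neg (a1 a2 : R) v : 0 < a1 -> 0 < a2 ->
  (two_phase a1 a2 v)^\- = (fun p => a2 * v^\- p).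
Proof.
move=> a1_gt0 a2_gt0; apply/funext => p; rewrite /two_phase /funrpos /funrneg.
have [v0|/ltW v0] := leP 0 (v p).
- have Nv0 : - v p <= 0 by rewrite oppr_le0.
  have av0 : - (a1 * v p) <= 0 by rewrite oppr_le0 mulr_ge0// ltW.
  by rewrite (max_idPr Nv0) mulr0 subr0 (max_idPr av0).
- have Nv0 : 0 <= - v p by rewrite oppr_ge0.
  have av0 : 0 <= a2 * - v p by rewrite mulr_ge0// ltW.
  by rewrite (max_idPl Nv0) mulr0 sub0r opprK (max_idPl av0).
Qed.

Lemma acf_two_phase (a1 a2 : R) v r : 0 < a1 -> 0 < a2 ->
  acf (two_phase a1 a2 v) r =
  ((r ^- 4)%:E * acf_energy (fun p => (a1 * v^\+ p)%R) r
               * acf_energy (fun p => (a2 * v^\- p)%R) r)%E.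
Proof.
move=> a1_gt0 a2_gt0; rewrite /acf.
rewrite (two_phase_pos v a1_gt0 a2_gt0).
rewrite (two_phase_neg v a1_gt0 a2_gt0).
reflexivity.
Qed.

End Heisenberg.

(* Main.v *)
(** The rotation (x, y, t) -> (-x, -y, t) preserves Lebesgue measure, the Koranyi
    norm and |grad u|^2 and changes the sign of u, so each phase carries half of
    the energy of u itself, up to the factors alpha_i^2. Here
      |grad u|^2 = 1 - 12 (x^2 + y^2) + 36 (x^2 + y^2)^2 + (6xy - 3t)^2,
    and by the dilations (rx, ry, r^2 t), whose Jacobian is r^4, the energy of u
    on the ball of radius r is r^2 P(r) with P(r) = A - 12 B r^2 + C r^4, where
    A, B, C are the integrals over the unit ball of 1, x^2 + y^2 and
    36 (x^2 + y^2)^2 + (6xy - 3t)^2 against |xi|^(-2). Hence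
    J(r) = (alpha_1 alpha_2 / 2)^2 P(r)^2, and P >= 0 decreases near 0 because
    B > 0. *)
Require Import Defs.
From HB Require Import structures.
From mathcomp Require Import all_boot all_order all_algebra.
From mathcomp Require Import all_classical all_reals all_analysis.
From mathcomp Require Import measurable_realfun.
From mathcomp Require Import ring lra.
Set Implicit Arguments.
Unset Strict Implicit.
Unset Printing Implicit Defensive.
Import Order.TTheory GRing.Theory Num.Theory.
Import numFieldNormedType.Exports.
Import HBNNSimple.
Local Open Scope classical_set_scope.
Local Open Scope ring_scope.

(** * Comparison of integrals off a null set *)

Section off_null_set.
Local Open Scope ereal_scope.
Context d (T : measurableType d) (R : realType).
Variable mu : {measure set T -> \bar R}.

(* Measurability of the integrands is not assumed: the derivatives of u^+ and
   u^- are unspecified on the zero set of u. Hence the recourse to simple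
   functions: multiplying one below [f] by the indicator of the complement of
   [N] does not change its integral. *)
Lemma ge0_le_integral_off_null (D N : set T) (f g : T -> \bar R) :
  measurable N -> mu N = 0 ->
  (forall x, D x -> 0 <= f x) -> (forall x, D x -> 0 <= g x) ->
  (forall x, D x -> ~ N x -> f x <= g x) ->
  \int[mu]_(x in D) f x <= \int[mu]_(x in D) g x.
Proof.
move=> mN muN0 f0 g0 fg; rewrite !ge0_integralE//.
apply: ge_ereal_sup => _ [h /= hf <-].
pose k := mul_nnsfun h (indic_nnsfun R (measurableC mN)).
have kE x : k x = (h x * \1_(~` N) x)%R by [].
apply: le_ereal_sup_tmp; exists (sintegral mu k).
  exists k => // x; rewrite kE indicE.
  have [xN|xN] := pselect (N x).
    by rewrite memNset ?mulr0; [exact: erestrict_ge0|exact].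
  rewrite mem_set// mulr1 (le_trans (hf x))// !patchE.
  by case: ifPn => // /set_mem xD; exact: fg.
rewrite -!integralT_nnsfun; apply: ae_ge0_le_integral; first exact: measurableT.
- by move=> x _; rewrite lee_fin fun_ge0.
- exact/measurable_EFinP.
- by move=> x _; rewrite lee_fin fun_ge0.
- exact/measurable_EFinP.
- exists N; split => // x /= xN; apply: contrapT => Nx; apply: xN => _.
  by suff : (h x)%:E <= (k x)%:E by []; rewrite kE indicE mem_set// mulr1.
Qed.

Lemma ge0_eq_integral_off_null (D N : set T) (f g : T -> \bar R) :
  measurable N -> mu N = 0 ->
  (forall x, D x -> 0 <= f x) -> (forall x, D x -> 0 <= g x) ->
  (forall x, D x -> ~ N x -> f x = g x) ->
  \int[mu]_(x in D) f x = \int[mu]_(x in D) g x.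
Proof.
move=> mN muN0 f0 g0 fg; apply/eqP; rewrite eq_le; apply/andP; split;
  by apply: (ge0_le_integral_off_null mN muN0) => // x Dx Nx; rewrite fg.
Qed.

End off_null_set.

(** * Maps that scale a measure by a constant factor *)

Section scaled_measure.
Local Open Scope ereal_scope.

(** The right-hand side is a measure in [A], a rescaled pushforward, that agrees with [m1 \x m2] on
    rectangles; the product measure is unique. *)
Lemma product_measure_scale_preimage d1 d2 (T1 : measurableType d1)
    (T2 : measurableType d2) (R : realType)
    (m1 : {sigma_finite_measure set T1 -> \bar R})
    (m2 : {sigma_finite_measure set T2 -> \bar R})
    (f1 : T1 -> T1) (f2 : T2 -> T2) (k1 k2 : R) :
  measurable_fun setT f1 -> measurable_fun setT f2 ->
  (0 <= k1)%R -> (0 <= k2)%R ->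
  (forall A, measurable A -> m1 A = k1%:E * m1 (f1 @^-1` A)) ->
  (forall A, measurable A -> m2 A = k2%:E * m2 (f2 @^-1` A)) ->
  forall A, measurable A ->
    (m1 \x m2) A =
    (k1 * k2)%:E * (m1 \x m2) ((fun p => (f1 p.1, f2 p.2)) @^-1` A).
Proof.
move=> mf1 mf2 k10 k20 m1E m2E A mA.
have mf : measurable_fun setT (fun p : T1 * T2 => (f1 p.1, f2 p.2)).
  by apply/measurable_fun_pair; exact: measurableT_comp.
pose m' : {measure set (T1 * T2) -> \bar R} :=
  mscale (NngNum (mulr_ge0 k10 k20)) (pushforward (m1 \x m2)
    (fun p : T1 * T2 => (f1 p.1, f2 p.2))).
rewrite (@product_measure_unique _ _ _ _ _ m1 m2 (m' mf))// => B C mB mC.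
transitivity ((k1 * k2)%:E * (m1 \x m2) ((f1 @^-1` B) `*` (f2 @^-1` C))) => //.
rewrite product_measure1E//; last 2 first.
  by rewrite -[X in measurable X]setTI; exact: mf1.
  by rewrite -[X in measurable X]setTI; exact: mf2.
by rewrite (m1E _ mB) (m2E _ mC) EFinM muleACA.
Qed.

(** By hypothesis [mu] is [k] times its own pushforward under [phi]; in the applications [k] is the
    absolute value of the Jacobian. *)
Lemma ge0_integral_scale_preimage d (T : measurableType d) (R : realType)
    (mu : {measure set T -> \bar R}) (phi : T -> T) (k : R)
    (D : set T) (f : T -> \bar R) :
  measurable_fun setT phi -> (0 <= k)%R ->
  (forall A, measurable A -> mu A = k%:E * mu (phi @^-1` A)) ->
  measurable D -> measurable_fun D f -> (forall x, D x -> 0 <= f x) ->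
  \int[mu]_(x in D) f x = k%:E * \int[mu]_(x in phi @^-1` D) f (phi x).
Proof.
move=> mphi k0 muE mD mf f0.
pose m' : {measure set T -> \bar R} := mscale (NngNum k0) (pushforward mu phi).
rewrite (eq_measure_integral (m' mphi)); last by move=> A mA _; exact: muE.
rewrite /m' ge0_integral_mscale// ge0_integral_pushforward// => y.
by rewrite inE; exact: f0.
Qed.

End scaled_measure.

(** * Diagonal linear maps and Lebesgue measure *)

Section diagonal_maps.
Local Open Scope ereal_scope.
Context {R : realType}.
Implicit Types (a b c : R).

Local Notation leb := (@lebesgue_measure R).

Lemma measurable_mulrl a :
  measurable_fun setT (fun x : measurableTypeR R => (a * x)%R : measurableTypeR R).
Proof. by apply: measurable_funM. Qed.

(** Lebesgue measure is determined by its values on the intervals []a, b]]. For [c < 0] their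
    preimages are half-open on the other side, hence the two cases. *)
Lemma lebesgue_measure_preimage_mulrl c (A : set R) : c != 0%R -> measurable A ->
  leb A = `|c|%:E * leb ((fun x => c * x)%R @^-1` A).
Proof.
move=> c0 mA.
pose m' : {measure set (measurableTypeR R) -> \bar R} :=
  mscale (NngNum (normr_ge0 c)) (pushforward leb
    (fun x : measurableTypeR R => (c * x)%R : measurableTypeR R)).
rewrite (@lebesgue_measure_unique R (m' (measurable_mulrl c)))//.
move=> _ [[a b]] _ <-.
have [cgt0|clt0|/eqP] := ltgtP 0%R c; last by rewrite eq_sym (negbTE c0).
  transitivity (`|c|%:E * leb `](c^-1 * a)%R, (c^-1 * b)%R]%classic); last first.
    congr (_ * leb _); apply/seteqP; split=> x /=;
      by rewrite !in_itv/= ltr_pdivrMl// ler_pdivlMl.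
  rewrite !lebesgue_measure_itv/= !lte_fin ltr_pM2l ?invr_gt0//.
  case: ifPn => _; last by rewrite mule0.
  by rewrite -!EFinD -EFinM gtr0_norm// mulrBr !mulVKf.
transitivity (`|c|%:E * leb `[(c^-1 * b)%R, (c^-1 * a)%R[%classic); last first.
  congr (_ * leb _); apply/seteqP; split=> x /=;
    by rewrite !in_itv/= ltr_ndivlMl// ler_ndivrMl// andbC.
rewrite !lebesgue_measure_itv/= !lte_fin ltr_nM2l ?invr_lt0//.
case: ifPn => _; last by rewrite mule0.
by rewrite -!EFinD -EFinM ltr0_norm// mulNr mulrBr !mulVKf// opprB.
Qed.

(* The library infers no sigma-finite structure on [leb \x leb], hence the
   alias. *)
Definition lebesgue_measure2 := (leb \x leb).

HB.instance Definition _ := Measure.on lebesgue_measure2.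

Lemma sigma_finite_lebesgue_measure2 : sigma_finite setT lebesgue_measure2.
Proof.
have /sigma_finiteP[F [TF ndF Foo]] := sigma_finiteT leb.
exists (fun n => F n `*` F n) => [|k].
  rewrite -setXTT TF predeqE => -[x y]; split=> [[/= [n _ Fnx] [k _ Fky]]|].
    (* The sequence [F] is nondecreasing, so one index serves both coordinates. *)
    exists (maxn n k) => //; split.
    - by move: x Fnx; exact/subsetPset/ndF/leq_maxl.
    - by move: y Fky; exact/subsetPset/ndF/leq_maxr.
  by move=> [n _ []/= ? ?]; split; exists n.
have [? ?] := Foo k; split; first exact: measurableX.
rewrite /lebesgue_measure2.
by rewrite product_measure1E// lte_mul_pinfty// ge0_fin_numE.
Qed.

HB.instance Definition _ := Measure_isSigmaFinite.Build _ _ _ lebesgue_measure2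
  sigma_finite_lebesgue_measure2.

(* The type on which [heis_measure] is defined. It is convertible to [heis R]
   but carries a different, equally convertible, measurable structure. *)
Local Notation mheis :=
  (measurableTypeR R * measurableTypeR R * measurableTypeR R)%type.

Definition heis_diag a b c (p : heis R) : heis R :=
  (a * p.1.1, b * p.1.2, c * p.2)%R.

Lemma measurable_heis_diag a b c : measurable_fun [set: mheis] (heis_diag a b c : mheis -> mheis).
Proof.
apply/measurable_fun_pair; first apply/measurable_fun_pair.
- by apply: measurable_funM => //; apply: measurableT_comp.
- by apply: measurable_funM => //; apply: measurableT_comp.
- by apply: measurable_funM.
Qed.

(** The product is iterated, so the one-dimensional scaling is combined twice: first on the plane
    ([f12]), then with the third coordinate. *)
Lemma heis_measure_preimage_diag a b c (A : set mheis) :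
  a != 0%R -> b != 0%R -> c != 0%R -> measurable A ->
  heis_measure A =
  (`|a| * `|b| * `|c|)%:E * heis_measure (heis_diag a b c @^-1` A).
Proof.
move=> a0 b0 c0 mA.
pose f12 := fun p : measurableTypeR R * measurableTypeR R =>
  (a * p.1, b * p.2)%R : measurableTypeR R * measurableTypeR R.
have mf12 : measurable_fun setT f12.
  by apply/measurable_fun_pair; apply: measurable_funM.
have f12E (B : set (measurableTypeR R * measurableTypeR R)) : measurable B ->
    lebesgue_measure2 B = (`|a| * `|b|)%:E * lebesgue_measure2 (f12 @^-1` B).
  apply: (product_measure_scale_preimage (@measurable_mulrl a)
    (@measurable_mulrl b) (normr_ge0 a) (normr_ge0 b)) => C.
    exact: lebesgue_measure_preimage_mulrl.
  exact: lebesgue_measure_preimage_mulrl.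
have ab0 : (0 <= `|a| * `|b|)%R by rewrite mulr_ge0.
have cE B : measurable B -> leb B = `|c|%:E * leb ([eta *%R c] @^-1` B).
  exact: lebesgue_measure_preimage_mulrl.
exact: (product_measure_scale_preimage mf12 (@measurable_mulrl c) ab0
  (normr_ge0 c) f12E cE mA).
Qed.

(** Used for the dilations [heis_diag r r (r ^+ 2)] and for the reflection
    [heis_diag (-1) (-1) 1]. *)
Lemma ge0_integral_heis_diag a b c (D : set mheis) (f : mheis -> \bar R) :
  a != 0%R -> b != 0%R -> c != 0%R ->
  measurable D -> measurable_fun D f -> (forall x, D x -> 0 <= f x) ->
  \int[@heis_measure R]_(p in D) f p =
  (`|a| * `|b| * `|c|)%:E *
    \int[@heis_measure R]_(p in heis_diag a b c @^-1` D) f (heis_diag a b c p).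
Proof.
move=> a0 b0 c0 mD mf f0; apply: ge0_integral_scale_preimage => //.
  exact: measurable_heis_diag.
by move=> A; exact: heis_measure_preimage_diag.
Qed.

End diagonal_maps.

(** * The Koranyi norm and its balls *)

Section koranyi_norm.
Context {R : realType}.
Implicit Types (p : heis R) (r : R).
Local Notation mheis :=
  (measurableTypeR R * measurableTypeR R * measurableTypeR R)%type.

Lemma measurable_xcoord : measurable_fun [set: mheis] (@xcoord R).
Proof. by apply: measurableT_comp. Qed.

Lemma measurable_ycoord : measurable_fun [set: mheis] (@ycoord R).
Proof. by apply: measurableT_comp. Qed.

Lemma measurable_tcoord : measurable_fun [set: mheis] (@tcoord R).
Proof. exact: measurable_snd. Qed.

Lemma measurable_koranyi : measurable_fun [set: mheis] (@koranyi R).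
Proof.
apply: (measurableT_comp (measurable_powR _)).
apply: measurable_funD; apply: measurable_funX; last exact: measurable_tcoord.
by apply: measurable_funD; apply: measurable_funX;
  [exact: measurable_xcoord|exact: measurable_ycoord].
Qed.

Lemma measurable_kball r : measurable (kball r : set mheis).
Proof.
rewrite (_ : kball r = (@koranyi R) @^-1` `]-oo, r[%classic).
  by rewrite -[X in measurable X]setTI; exact: measurable_koranyi.
by apply/seteqP; split => p; rewrite /kball /= in_itv.
Qed.

Lemma koranyi_ge0 p : 0 <= koranyi p.
Proof. exact: powR_ge0. Qed.

Lemma koranyi_pow4 p :
  koranyi p ^+ 4 = (xcoord p ^+ 2 + ycoord p ^+ 2) ^+ 2 + tcoord p ^+ 2.
Proof.
have N0 : 0 <= (xcoord p ^+ 2 + ycoord p ^+ 2) ^+ 2 + tcoord p ^+ 2.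
  by rewrite addr_ge0// sqr_ge0.
by rewrite -powR_mulrn ?koranyi_ge0// /koranyi -powRrM mulVf// powRr1.
Qed.

(** Reduces identities for the norm to polynomial identities between fourth powers, which [ring]
    settles. *)
Lemma koranyi_unique p r : 0 <= r ->
  r ^+ 4 = (xcoord p ^+ 2 + ycoord p ^+ 2) ^+ 2 + tcoord p ^+ 2 -> koranyi p = r.
Proof.
by move=> r0; rewrite -koranyi_pow4 => /eqP; rewrite eqrXn2 ?koranyi_ge0//
  => /eqP.
Qed.

Lemma koranyi_dilation r p : 0 <= r ->
  koranyi (heis_diag r r (r ^+ 2) p) = r * koranyi p.
Proof.
move=> r0; apply: koranyi_unique; first by rewrite mulr_ge0// koranyi_ge0.
by rewrite exprMn koranyi_pow4 /xcoord /ycoord /tcoord /heis_diag/=; ring.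
Qed.

Lemma koranyi_reflection p : koranyi (heis_diag (-1) (-1) 1 p) = koranyi p.
Proof.
apply: koranyi_unique; first exact: koranyi_ge0.
by rewrite koranyi_pow4 /xcoord /ycoord /tcoord /heis_diag/=; ring.
Qed.

Lemma preimage_dilation_kball r s : 0 < r ->
  heis_diag r r (r ^+ 2) @^-1` kball s = kball (r^-1 * s).
Proof.
move=> r0; apply/seteqP; split => p; rewrite /kball /=;
  by rewrite koranyi_dilation 1?ltW// ltr_pdivlMl.
Qed.

Lemma preimage_reflection_kball r :
  heis_diag (-1) (-1) 1 @^-1` kball r = kball r.
Proof.
by apply/seteqP; split => p; rewrite /kball /= koranyi_reflection.
Qed.

Lemma sq_horizontal_le_koranyi p :
  xcoord p ^+ 2 + ycoord p ^+ 2 <= koranyi p ^+ 2.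
Proof.
have h0 : 0 <= xcoord p ^+ 2 + ycoord p ^+ 2 by rewrite addr_ge0// sqr_ge0.
rewrite -(@ler_pXn2r _ 2)// ?nnegrE ?sqr_ge0//.
by rewrite -exprM koranyi_pow4 lerDl sqr_ge0.
Qed.

Lemma vertical_le_koranyi p : `|tcoord p| <= koranyi p ^+ 2.
Proof.
rewrite -(@ler_pXn2r _ 2)// ?nnegrE ?sqr_ge0//.
by rewrite -exprM koranyi_pow4 real_normK ?num_real// lerDr sqr_ge0.
Qed.

(** The side [[-1, 1]] gives a cube around the unit ball, the side [[1/4, 1/2]] a cube inside it. *)
Definition heis_box (a b : R) : set (heis R) :=
  (`[a, b]%classic `*` `[a, b]%classic) `*` `[a, b]%classic.

Lemma measurable_heis_box a b : measurable (heis_box a b : set mheis).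
Proof. by apply: measurableX => //; apply: measurableX. Qed.

Lemma heis_measure_box (a b : R) : a <= b ->
  heis_measure (heis_box a b) = ((b - a) ^+ 3)%:E.
Proof.
move=> ab; rewrite /heis_measure product_measure1E//; last exact: measurableX.
rewrite /= product_measure1E//.
have abE : lebesgue_measure (`[a, b]%classic : set R) = (b - a)%:E.
  rewrite lebesgue_measure_itv/= lte_fin.
  move: ab; rewrite le_eqVlt => /predU1P[->|->]; last by rewrite -EFinB.
  by rewrite ltxx subrr.
transitivity ((b - a)%:E * (b - a)%:E * (b - a)%:E)%E.
  by congr (_ * _ * _)%E; exact: abE.
by rewrite -!EFinM !exprSr expr0 mul1r.
Qed.

(** On the unit ball both x^2 + y^2 and |t| are at most [koranyi p ^+ 2], hence at most 1. *)
Lemma kball1_sub_box : kball 1 `<=` heis_box (-1) 1.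
Proof.
move=> p; rewrite /kball /= => p1.
have k1 : koranyi p ^+ 2 <= 1 by rewrite expr_le1 ?koranyi_ge0// ltW.
have := le_trans (sq_horizontal_le_koranyi p) k1.
have := le_trans (vertical_le_koranyi p) k1.
rewrite ler_norml => t1 xy1.
rewrite /heis_box/= !in_itv/= -!ler_norml.
rewrite -[`|p.1.1|]/(`|xcoord p|) -[`|p.1.2|]/(`|ycoord p|) -[`|p.2|]/(`|tcoord p|).
split; [split|]; last by rewrite ler_norml.
- by rewrite ler_norml; apply/andP; split; nra.
- by rewrite ler_norml; apply/andP; split; nra.
Qed.

Lemma heis_measure_kball1 : (heis_measure (@kball R 1%R) <= 8%:R%:E)%E.
Proof.
apply: (@le_trans _ _ (heis_measure (heis_box (-1) 1))).
  apply: le_measure; rewrite ?inE; [exact: measurable_kball|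
    exact: measurable_heis_box|exact: kball1_sub_box].
rewrite heis_measure_box; last by lra.
by rewrite lee_fin; lra.
Qed.

End koranyi_norm.

(** * Integrability of [koranyi p ^- 2] on the unit ball *)

Section koranyi_integrability.
Local Open Scope ereal_scope.
Context {R : realType}.
Implicit Types (p : heis R) (a b r : R).
Local Notation mu := (@heis_measure R).
Local Notation mheis :=
  (measurableTypeR R * measurableTypeR R * measurableTypeR R)%type.

Definition koranyi_annulus a b : set (heis R) :=
  [set p | (a <= koranyi p < b)%R].

Lemma measurable_koranyi_annulus a b : measurable (koranyi_annulus a b : set mheis).
Proof.
rewrite (_ : koranyi_annulus a b = (@koranyi R) @^-1` `[a, b[%classic).
  by rewrite -[X in measurable X]setTI; exact: measurable_koranyi.
by apply/seteqP; split => p; rewrite /koranyi_annulus /= in_itv.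
Qed.

Lemma measurable_koranyi_exprN2 (D : set mheis) :
  measurable_fun D (fun p : mheis => koranyi p ^- 2)%R.
Proof.
apply: measurable_funTS.
(* Valid also where [koranyi p] is 0: both sides are then 0. *)
have -> : (fun p => koranyi p ^- 2)%R = (fun p => koranyi p `^ (- 2%:R))%R.
  by apply/funext => p; rewrite powR_invn// koranyi_ge0.
exact: (measurableT_comp (measurable_powR _) measurable_koranyi).
Qed.

Lemma measurable_koranyi_sqV (D : set mheis) :
  measurable_fun D (fun p => (koranyi p ^- 2)%:E).
Proof. by apply/measurable_EFinP; exact: measurable_koranyi_exprN2. Qed.

Lemma koranyi_exprN2_ge0 p : (0 <= koranyi p ^- 2)%R.
Proof. by rewrite invr_ge0 sqr_ge0. Qed.

Lemma koranyi_sqV_ge0 p : 0 <= (koranyi p ^- 2)%:E.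
Proof. by rewrite lee_fin koranyi_exprN2_ge0. Qed.

(** The Jacobian r^4 times the factor r^(-2) from the weight leaves r^2. *)
Lemma integral_koranyi_annulus_dilation r a b : (0 < r)%R ->
  \int[mu]_(p in koranyi_annulus (r * a) (r * b)) (koranyi p ^- 2)%:E =
  (r ^+ 2)%:E * \int[mu]_(p in koranyi_annulus a b) (koranyi p ^- 2)%:E.
Proof.
move=> r0; have rn0 : r != 0%R by rewrite gt_eqF.
have rn2 : (r ^+ 2)%R != 0%R by rewrite expf_neq0.
rewrite (ge0_integral_heis_diag rn0 rn0 rn2 (measurable_koranyi_annulus _ _)
  (@measurable_koranyi_sqV _) (fun p _ => koranyi_sqV_ge0 p)).
rewrite (_ : _ @^-1` _ = koranyi_annulus a b); last first.
  apply/seteqP; split => p; rewrite /koranyi_annulus/= koranyi_dilation ?(ltW r0)//;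
    by rewrite ler_pM2l// ltr_pM2l.
under eq_integral do rewrite koranyi_dilation ?(ltW r0)// exprMn invfM EFinM.
rewrite (ge0_integralZl mu (measurable_koranyi_annulus _ _)
  (@measurable_koranyi_sqV _) (fun p _ => koranyi_sqV_ge0 p)); last first.
  by rewrite lee_fin invr_ge0 sqr_ge0.
rewrite muleA -EFinM; congr (_%:E * _).
by rewrite !gtr0_norm ?exprn_gt0//; field.
Qed.

(** The weight is at most 4 on this annulus, which lies in a ball of measure at most 8. *)
Lemma integral_koranyi_annulus_half :
  \int[mu]_(p in koranyi_annulus (2^-1) 1) (koranyi p ^- 2)%:E <= 32%:R%:E.
Proof.
apply: (@le_trans _ _ (\int[mu]_(p in koranyi_annulus (2^-1) 1) (cst 4%:R%:E p))).
  apply: ge0_le_integral; first exact: measurable_koranyi_annulus.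
  - by move=> p _; exact: koranyi_sqV_ge0.
  - exact: measurable_koranyi_sqV.
  - exact: measurable_cst.
  - move=> p /andP[k2 _]; rewrite lee_fin.
    have k0 : (0 < koranyi p)%R by apply: lt_le_trans k2; rewrite invr_gt0.
    rewrite -[leRHS]invrK lef_pV2 ?posrE ?exprn_gt0//.
    have : (2^-1 ^+ 2 <= koranyi p ^+ 2)%R by rewrite lerXn2r// ?nnegrE ?ltW.
    by apply: le_trans; lra.
rewrite integral_cst; last exact: measurable_koranyi_annulus.
apply: (@le_trans _ _ (4%:R%:E * 8%:R%:E)); last by rewrite -EFinM lee_fin; lra.
rewrite lee_pmul2l//; apply: le_trans heis_measure_kball1.
apply: le_measure; rewrite ?inE; [exact: measurable_koranyi_annulus|
  exact: measurable_kball|by move=> p /andP[]].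
Qed.

(* The annuli shrink by dilation, so I (n + 1) <= 32 + I n / 4. *)
Lemma integral_koranyi_annulus_bound n :
  \int[mu]_(p in koranyi_annulus (2^-1 ^+ n) 1) (koranyi p ^- 2)%:E <= 64%:R%:E.
Proof.
elim: n => [|n IHn].
  rewrite (_ : koranyi_annulus _ _ = set0) ?integral_set0 ?lee_fin//.
  apply/seteqP; split => // p; rewrite /koranyi_annulus/= expr0.
  by move=> /andP[/le_lt_trans] /[apply]; rewrite ltxx.
have n1 : (2^-1 ^+ n.+1 <= 2^-1 :> R)%R.
  by rewrite exprS ler_piMr// exprn_ile1//; lra.
have UE : koranyi_annulus (2^-1 ^+ n.+1) 1 =
    koranyi_annulus (2^-1 * 2^-1 ^+ n) (2^-1 * 1) `|` koranyi_annulus (2^-1) 1.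
  rewrite -exprS mulr1; apply/seteqP; split => p; rewrite /koranyi_annulus/=.
    by case: (ltP (koranyi p) 2^-1%R) => k2 /andP[-> ->]; [left|right].
  move=> [/andP[-> k2]|/andP[k2 ->]] /=; first by apply: lt_trans k2 _; lra.
  by rewrite (le_trans n1).
rewrite UE ge0_integral_setU//; last 5 first.
- exact: measurable_koranyi_annulus.
- exact: measurable_koranyi_annulus.
- exact: measurable_koranyi_sqV.
- by move=> p _; exact: koranyi_sqV_ge0.
- apply/disj_set2P; rewrite -subset0 mulr1 => p [/andP[_ k1] /andP[k2 _]].
  by have := lt_le_trans k1 k2; rewrite ltxx.
rewrite integral_koranyi_annulus_dilation; last by lra.
(* Since 64 / 4 + 32 = 48, the bound 64 reproduces itself. *)
apply: (@le_trans _ _ ((2^-1 ^+ 2)%:E * 64%:R%:E + 32%:R%:E)).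
  apply: leeD; last exact: integral_koranyi_annulus_half.
  by apply: lee_wpmul2l => //; rewrite lee_fin sqr_ge0.
by rewrite -EFinM -EFinD lee_fin; lra.
Qed.

(** The annuli [F n] exhaust the ball apart from the zeros of the norm; monotone convergence carries
    the uniform bound 64 to the limit. *)
Lemma integrable_koranyi_sqV :
  mu.-integrable (kball 1) (fun p => (koranyi p ^- 2)%:E).
Proof.
apply/integrableP; split; first exact: measurable_koranyi_sqV.
under eq_integral do rewrite gee0_abs ?koranyi_sqV_ge0//.
pose F n := koranyi_annulus (2^-1 ^+ n) 1.
have -> : \int[mu]_(p in kball 1) (koranyi p ^- 2)%:E =
    \int[mu]_(p in \bigcup_n F n) (koranyi p ^- 2)%:E.
  rewrite integral_mkcond [RHS]integral_mkcond; apply: eq_integral => p _.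
  rewrite !patchE; case: ifPn => [|] p1; last first.
    by rewrite memNset// => -[n _ /andP[_ p1']]; move: p1; rewrite notin_setE.
  case: ifPn => // pF.
  (* Where the norm vanishes, the weight is 0 as well, because [0^-1 = 0]. *)
  have [k0|k0] := eqVneq (koranyi p) 0%R; first by rewrite k0 expr0n invr0.
  have kgt0 : (0 < koranyi p)%R by rewrite lt_neqAle eq_sym k0 koranyi_ge0.
  move: p1 pF; rewrite inE notin_setE => p1 pF; case: pF.
  have half1 : (`|2^-1| < 1 :> R)%R by rewrite gtr0_norm ?invr_gt0// invf_lt1// ltr1n.
  (* Some power of 1/2 falls below [koranyi p], which places [p] in an annulus and contradicts
     [pF]. *)
  have /cvgrPdist_lt/(_ _ kgt0)[n _ /(_ n (leqnn n))] := cvg_expr half1.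
  rewrite sub0r normrN ger0_norm ?exprn_ge0//.
  by move=> /ltW nk; exists n => //; apply/andP.
have cvgI : \int[mu]_(p in F n) (koranyi p ^- 2)%:E @[n --> \oo] -->
    \int[mu]_(p in \bigcup_n F n) (koranyi p ^- 2)%:E.
  apply: ge0_nondecreasing_set_cvg_integral => //.
  - apply/nondecreasing_seqP => n; apply/subsetPset => p /andP[kn k1].
    apply/andP; split => //; apply: le_trans kn.
    by rewrite exprS ler_piMl ?exprn_ge0//; lra.
  - by move=> n; exact: measurable_koranyi_annulus.
  - by move=> n; exact: measurable_koranyi_sqV.
  - by move=> n p _; exact: koranyi_sqV_ge0.
rewrite -(cvg_lim _ cvgI)//; apply: (@le_lt_trans _ _ 64%:R%:E); last exact: ltry.
apply: lime_le; first by apply/cvg_ex; eexists; exact: cvgI.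
by apply: nearW => n; exact: integral_koranyi_annulus_bound.
Qed.

End koranyi_integrability.

(** * Horizontal gradients of [heis_u] and of its two phases *)

Section horizontal_gradient.
Context {R : realType}.
Implicit Types (p v : heis R) (f : heis R -> R) (h k : R).

(** A directional derivative sees only the values of [f] on the line near [p]. Where these form a
    polynomial in [h], it is a formal derivative. *)
Lemma derive_along_poly f p v (q : {poly R}) :
  (\forall h \near (0 : R), f (h *: (v : R * R * R) + p) = q.[h]) ->
  'D_(v : R * R * R) (f : R * R * R -> R) p = q^`().[0].
Proof.
move=> fq; rewrite derive.derivE derive1E.
have <- : 'D_(1 : R) (fun h : R => f (h *: (v : R * R * R) + p)) 0 = 'D_1 (horner q) 0.
  exact: (near_eq_derive _ fq).
rewrite /derive /=; congr (lim (_ @ 0^')); apply/funext => h /=.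
by rewrite addr0 scale0r add0r -[h%:A]/(h * 1) mulr1.
Qed.

Definition heis_u_line p v : {poly R} :=
  let x := p.1.1%:P + v.1.1 *: 'X in
  let y := p.1.2%:P + v.1.2 *: 'X in
  let t := p.2%:P + v.2 *: 'X in
  x - 3 *: (y * t) - 2 *: x ^+ 3.

Lemma heis_u_lineE p v h :
  heis_u (h *: (v : R * R * R) + p) = (heis_u_line p v).[h].
Proof.
rewrite /heis_u_line !hornerE /heis_u /xcoord /ycoord /tcoord /=.
rewrite -![_ *: _]/(_ * _).
ring.
Qed.

Definition heis_u_deriv p v : R :=
  v.1.1 - 3 * (v.1.2 * p.2 + p.1.2 * v.2) - 6 * p.1.1 ^+ 2 * v.1.1.

(** Off the zero set of [heis_u], a phase with coefficient [a] agrees near [p] on each line with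
    [k * heis_u], where [k] is [a], [- a] or 0; the factor [k] covers all these cases. *)
Lemma derive_heis_u_scale f k p v :
  (\forall h \near (0 : R), f (h *: (v : R * R * R) + p) =
     k * heis_u (h *: (v : R * R * R) + p)) ->
  'D_(v : R * R * R) (f : R * R * R -> R) p = k * heis_u_deriv p v.
Proof.
move=> fu; rewrite (@derive_along_poly _ _ _ (k *: heis_u_line p v)); last first.
  by near=> h; rewrite hornerZ -heis_u_lineE; near: h.
rewrite derivZ hornerZ /heis_u_line /heis_u_deriv; congr (_ * _).
by rewrite !poly.derivE !hornerE /=; ring.
Unshelve. all: by end_near. Qed.

(** Here X u = 1 - 6 (x^2 + y^2) and Y u = 6xy - 3t. *)
Definition heis_u_grad_sq p : R :=
  (1 - 6 * (xcoord p ^+ 2 + ycoord p ^+ 2)) ^+ 2 +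
  (6 * (xcoord p * ycoord p) - 3 * tcoord p) ^+ 2.

Lemma hgrad_sq_heis_u_scale f k p :
  (forall v, \forall h \near (0 : R), f (h *: (v : R * R * R) + p) =
     k * heis_u (h *: (v : R * R * R) + p)) ->
  hgrad_sq f p = k ^+ 2 * heis_u_grad_sq p.
Proof.
move=> fu; rewrite /hgrad_sq /hgrad/= /heisX /heisY.
rewrite /partial_x /partial_y /partial_t !(derive_heis_u_scale (fu _)).
by rewrite /heis_u_deriv /heis_u_grad_sq /xcoord /ycoord /tcoord /=; ring.
Qed.

(** Continuity along the line suffices, as only directional derivatives are taken. *)
Lemma near_heis_u_gt0 p v : 0 < heis_u p ->
  \forall h \near (0 : R), 0 < heis_u (h *: (v : R * R * R) + p).
Proof.
move=> up.
have q0 : 0 < (heis_u_line p v).[0] by rewrite -heis_u_lineE scale0r add0r.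
have qc : (heis_u_line p v).[h] @[h --> (0 : R)] --> (heis_u_line p v).[0].
  exact: continuous_horner.
near=> h; rewrite heis_u_lineE; near: h; exact: (cvgr_gt _ qc _ q0).
Unshelve. all: by end_near. Qed.

Lemma near_heis_u_lt0 p v : heis_u p < 0 ->
  \forall h \near (0 : R), heis_u (h *: (v : R * R * R) + p) < 0.
Proof.
move=> up.
have q0 : (heis_u_line p v).[0] < 0 by rewrite -heis_u_lineE scale0r add0r.
have qc : (heis_u_line p v).[h] @[h --> (0 : R)] --> (heis_u_line p v).[0].
  exact: continuous_horner.
near=> h; rewrite heis_u_lineE; near: h; exact: (cvgr_lt _ qc _ q0).
Unshelve. all: by end_near. Qed.

Lemma hgrad_sq_funrpos_heis_u k p : heis_u p != 0 ->
  hgrad_sq (fun p => k * (@heis_u R)^\+ p) p =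
  if 0 < heis_u p then k ^+ 2 * heis_u_grad_sq p else 0.
Proof.
move=> u0; case: ltP => up.
  apply: hgrad_sq_heis_u_scale => v; apply: filterS (near_heis_u_gt0 v up) => h uh.
  by rewrite /funrpos (max_idPl (ltW uh)).
have {u0}up : heis_u p < 0 by rewrite lt_neqAle u0.
(* The positive part vanishes nearby, so it is locally 0 times [heis_u]. *)
rewrite (@hgrad_sq_heis_u_scale _ 0) ?expr0n ?mul0r// => v.
apply: filterS (near_heis_u_lt0 v up) => h uh.
by rewrite /funrpos (max_idPr (ltW uh)) mulr0 mul0r.
Qed.

Lemma hgrad_sq_funrneg_heis_u k p : heis_u p != 0 ->
  hgrad_sq (fun p => k * (@heis_u R)^\- p) p =
  if heis_u p < 0 then k ^+ 2 * heis_u_grad_sq p else 0.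
Proof.
move=> u0; case: ltP => up.
  (* The negative part is locally [- heis_u], so the factor is [- k]. *)
  rewrite -sqrrN; apply: hgrad_sq_heis_u_scale => v.
  apply: filterS (near_heis_u_lt0 v up) => h uh.
  by rewrite /funrneg max_l ?mulrN ?mulNr// oppr_ge0 ltW.
have {u0}up : 0 < heis_u p by rewrite lt_neqAle eq_sym u0.
rewrite (@hgrad_sq_heis_u_scale _ 0) ?expr0n ?mul0r// => v.
apply: filterS (near_heis_u_gt0 v up) => h uh.
by rewrite /funrneg max_r ?mulr0 ?mul0r// oppr_le0 ltW.
Qed.

End horizontal_gradient.

(** * The zero set of [heis_u] is null *)

Section nodal_set.
Local Open Scope ereal_scope.
Context {R : realType}.
Local Notation mheis :=
  (measurableTypeR R * measurableTypeR R * measurableTypeR R)%type.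

Lemma measurable_heis_u : measurable_fun [set: mheis] (@heis_u R).
Proof.
have mx := @measurable_xcoord R; have my := @measurable_ycoord R.
have mt := @measurable_tcoord R.
apply: measurable_funB; last by apply: measurable_funM => //; apply: measurable_funX.
apply: measurable_funB => //.
by apply: measurable_funM => //; apply: measurable_funM.
Qed.

Definition heis_u_zero : set mheis := [set p | heis_u p = 0%R].

Lemma measurable_heis_u_zero : measurable heis_u_zero.
Proof.
rewrite (_ : heis_u_zero = (@heis_u R) @^-1` [set 0%R])//.
by rewrite -[X in measurable X]setTI; exact: measurable_heis_u.
Qed.

(* For fixed x and y <> 0, u is affine in t with slope -3y. *)
Lemma heis_measure_heis_u_zero : heis_measure heis_u_zero = 0.
Proof.
(* Where y = 0, u does not depend on t, and a section of the zero set may be all of R. *)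
pose N : set (measurableTypeR R * measurableTypeR R) := [set: R] `*` [set 0%R].
have mN : measurable N by apply: measurableX.
have N0 : lebesgue_measure2 N = 0.
  rewrite /lebesgue_measure2 product_measure1E//.
  transitivity (@lebesgue_measure R setT * 0); last by rewrite mule0.
  by congr (_ * _); exact: lebesgue_measure_set1.
apply/eqP; rewrite eq_le measure_ge0 andbT.
(* The product measure is the integral over the plane of the measures of the sections, to be
   compared with the integral of 0 off [N]. *)
rewrite -[leRHS](integral0 lebesgue_measure2 setT).
apply: (ge0_le_integral_off_null mN N0) => // -[x y] _ xyN.
have y0 : y != 0%R by apply/eqP => y0; apply: xyN.
(* The only zero of u on the vertical line over (x, y). *)
pose t := ((x - 2 * x ^+ 3) / (3 * y))%R.
rewrite /= -(@lebesgue_measure_set1 R t); apply: le_measure; rewrite ?inE//.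
  by apply: measurable_xsection; exact: measurable_heis_u_zero.
move=> s; rewrite /xsection/= inE /heis_u_zero/= /heis_u /xcoord /ycoord /tcoord/=.
move=> us; have tE : (x - 2 * x ^+ 3 = 3 * y * s)%R.
  by apply/eqP; rewrite -subr_eq0 -us; apply/eqP; ring.
by rewrite /t tE; field.
Qed.

End nodal_set.

(** * Energies of the two phases *)

Section energies.
Local Open Scope ereal_scope.
Context {R : realType}.
Implicit Types (p : heis R) (r k : R).
Local Notation mu := (@heis_measure R).
Local Notation mheis :=
  (measurableTypeR R * measurableTypeR R * measurableTypeR R)%type.

Lemma heis_u_grad_sq_ge0 p : (0 <= heis_u_grad_sq p)%R.
Proof. by rewrite addr_ge0 ?sqr_ge0. Qed.

Lemma heis_u_reflection p : heis_u (heis_diag (-1) (-1) 1 p) = (- heis_u p)%R.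
Proof.
by rewrite /heis_u /heis_diag /xcoord /ycoord /tcoord/=; ring.
Qed.

Lemma heis_u_grad_sq_reflection p :
  heis_u_grad_sq (heis_diag (-1) (-1) 1 p) = heis_u_grad_sq p.
Proof.
by rewrite /heis_u_grad_sq /heis_diag /xcoord /ycoord /tcoord/=; ring.
Qed.

Lemma measurable_heis_u_grad_sq : measurable_fun [set: mheis] (@heis_u_grad_sq R).
Proof.
have mx := @measurable_xcoord R; have my := @measurable_ycoord R.
have mt := @measurable_tcoord R.
apply: measurable_funD; apply: measurable_funX; apply: measurable_funB => //;
  apply: measurable_funM => //.
- by apply: measurable_funD; apply: measurable_funX.
- exact: measurable_funM.
Qed.

(** On the zero set of [heis_u] the value 0 replaces the unspecified derivatives, which makes this
    density and the next one measurable. *)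
Definition pos_density p : \bar R :=
  ((if (0 < heis_u p)%R then heis_u_grad_sq p else 0) * koranyi p ^- 2)%:E.
Definition neg_density p : \bar R :=
  ((if (heis_u p < 0)%R then heis_u_grad_sq p else 0) * koranyi p ^- 2)%:E.
Definition density p : \bar R := (heis_u_grad_sq p * koranyi p ^- 2)%:E.

Lemma pos_density_ge0 p : 0 <= pos_density p.
Proof.
rewrite lee_fin mulr_ge0 ?koranyi_exprN2_ge0//.
by case: ifP; rewrite ?heis_u_grad_sq_ge0.
Qed.

Lemma neg_density_ge0 p : 0 <= neg_density p.
Proof.
rewrite lee_fin mulr_ge0 ?koranyi_exprN2_ge0//.
by case: ifP; rewrite ?heis_u_grad_sq_ge0.
Qed.

Lemma density_ge0 p : 0 <= density p.
Proof. by rewrite lee_fin mulr_ge0 ?koranyi_exprN2_ge0// heis_u_grad_sq_ge0. Qed.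

Lemma measurable_density (D : set mheis) : measurable_fun D density.
Proof.
apply: measurable_funTS; apply/measurable_EFinP; apply: measurable_funM.
  exact: measurable_heis_u_grad_sq.
exact: measurable_koranyi_exprN2.
Qed.

Lemma measurable_pos_density (D : set mheis) : measurable_fun D pos_density.
Proof.
apply: measurable_funTS; apply/measurable_EFinP; apply: measurable_funM.
  apply: measurable_fun_ifT => //; last exact: measurable_heis_u_grad_sq.
  by apply: measurable_fun_ltr => //; exact: measurable_heis_u.
exact: measurable_koranyi_exprN2.
Qed.

Lemma measurable_neg_density (D : set mheis) : measurable_fun D neg_density.
Proof.
apply: measurable_funTS; apply/measurable_EFinP; apply: measurable_funM.
  apply: measurable_fun_ifT => //; last exact: measurable_heis_u_grad_sq.
  by apply: measurable_fun_ltr => //; exact: measurable_heis_u.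
exact: measurable_koranyi_exprN2.
Qed.

(** The integrands agree off the zero set of [heis_u]. Measurability of the left one is not known,
    hence the comparison off a null set. *)
Lemma acf_energy_funrpos_heis_u k r :
  acf_energy (fun p => k * (@heis_u R)^\+ p)%R r =
  (k ^+ 2)%:E * \int[mu]_(p in kball r) pos_density p.
Proof.
rewrite -(ge0_integralZl mu (measurable_kball r) (@measurable_pos_density _)
  (fun p _ => pos_density_ge0 p)); last by rewrite lee_fin sqr_ge0.
apply: (ge0_eq_integral_off_null (mu := mu) measurable_heis_u_zero
  heis_measure_heis_u_zero) => p.
- move=> _; rewrite lee_fin mulr_ge0 ?koranyi_exprN2_ge0//.
  by rewrite /hgrad_sq addr_ge0// sqr_ge0.
- by move=> _; rewrite mule_ge0 ?pos_density_ge0// lee_fin sqr_ge0.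
- move=> _ /eqP u0; rewrite hgrad_sq_funrpos_heis_u// /pos_density -EFinM mulrA.
  by case: ifP; rewrite ?mulr0.
Qed.

Lemma acf_energy_funrneg_heis_u k r :
  acf_energy (fun p => k * (@heis_u R)^\- p)%R r =
  (k ^+ 2)%:E * \int[mu]_(p in kball r) neg_density p.
Proof.
rewrite -(ge0_integralZl mu (measurable_kball r) (@measurable_neg_density _)
  (fun p _ => neg_density_ge0 p)); last by rewrite lee_fin sqr_ge0.
apply: (ge0_eq_integral_off_null (mu := mu) measurable_heis_u_zero
  heis_measure_heis_u_zero) => p.
- move=> _; rewrite lee_fin mulr_ge0 ?koranyi_exprN2_ge0//.
  by rewrite /hgrad_sq addr_ge0// sqr_ge0.
- by move=> _; rewrite mule_ge0 ?neg_density_ge0// lee_fin sqr_ge0.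
- move=> _ /eqP u0; rewrite hgrad_sq_funrneg_heis_u// /neg_density -EFinM mulrA.
  by case: ifP; rewrite ?mulr0.
Qed.

(** The reflection has Jacobian 1 in absolute value, preserves the ball and turns one density into
    the other. *)
Lemma integral_neg_density r :
  \int[mu]_(p in kball r) neg_density p = \int[mu]_(p in kball r) pos_density p.
Proof.
have N10 : (-1 : R)%R != 0%R by rewrite oppr_eq0 oner_neq0.
rewrite (ge0_integral_heis_diag N10 N10 (oner_neq0 R) (measurable_kball r)
  (@measurable_neg_density _) (fun p _ => neg_density_ge0 p)).
rewrite normrN normr1 !mulr1 mul1e preimage_reflection_kball.
apply: eq_integral => p _; rewrite /neg_density /pos_density.
by rewrite heis_u_reflection heis_u_grad_sq_reflection koranyi_reflection oppr_lt0.
Qed.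

(** Off the zero set exactly one sign condition holds, so [density] is the sum of the two densities.
    On the zero set both vanish, while [density] need not. *)
Lemma integral_density r :
  \int[mu]_(p in kball r) density p =
  \int[mu]_(p in kball r) pos_density p + \int[mu]_(p in kball r) pos_density p.
Proof.
rewrite -[X in _ + X]integral_neg_density.
rewrite -(ge0_integralD mu (measurable_kball r) (fun p _ => pos_density_ge0 p)
  (@measurable_pos_density _) (fun p _ => neg_density_ge0 p)
  (@measurable_neg_density _)).
apply: (ge0_eq_integral_off_null (mu := mu) measurable_heis_u_zero
  heis_measure_heis_u_zero) => p.
- by move=> _; exact: density_ge0.
- by move=> _; rewrite adde_ge0 ?neg_density_ge0 ?pos_density_ge0.
- move=> _ /eqP u0; rewrite /density /pos_density /neg_density -EFinD -mulrDl.
  by case: ltgtP u0; rewrite ?addr0 ?add0r.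
Qed.

Definition horizontal_sq p : R := (xcoord p ^+ 2 + ycoord p ^+ 2)%R.

(** The part of [heis_u_grad_sq] of degree 4 under the dilations, where t has degree 2; the part of
    degree 2 is [-12 * horizontal_sq p]. *)
Definition quartic_part p : R :=
  (36 * (xcoord p ^+ 2 + ycoord p ^+ 2) ^+ 2 +
   (6 * (xcoord p * ycoord p) - 3 * tcoord p) ^+ 2)%R.

Lemma heis_u_grad_sq_dilation r p :
  heis_u_grad_sq (heis_diag r r (r ^+ 2) p) =
  (1 + (- (12 * r ^+ 2)) * horizontal_sq p + r ^+ 4 * quartic_part p)%R.
Proof.
by rewrite /heis_u_grad_sq /horizontal_sq /quartic_part /heis_diag
  /xcoord /ycoord /tcoord/=; ring.
Qed.

Lemma measurable_horizontal_sq : measurable_fun [set: mheis] horizontal_sq.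
Proof.
by apply: measurable_funD; apply: measurable_funX;
  [exact: measurable_xcoord|exact: measurable_ycoord].
Qed.

Lemma measurable_quartic_part : measurable_fun [set: mheis] quartic_part.
Proof.
apply: measurable_funD.
  by apply: measurable_funM => //; apply: measurable_funX; exact: measurable_horizontal_sq.
apply: measurable_funX; apply: measurable_funB; apply: measurable_funM => //.
  by apply: measurable_funM; [exact: measurable_xcoord|exact: measurable_ycoord].
exact: measurable_tcoord.
Qed.

Lemma integrable_bounded_koranyi_sqV (g : heis R -> R) (M : R) :
  measurable_fun [set: mheis] (g : mheis -> R) ->
  (forall p, kball 1 p -> (`|g p| <= M)%R) ->
  mu.-integrable (kball 1) (EFin \o (fun p => g p * koranyi p ^- 2)%R).
Proof.
move=> mg gM.
have mD := measurable_kball (1 : R).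
apply: (le_integrable mD _ _ (integrableZl mD M (@integrable_koranyi_sqV R))).
  apply/measurable_EFinP; apply: measurable_funM; first exact: measurable_funTS.
  exact: measurable_koranyi_exprN2.
move=> p /gM gpM /=; rewrite lee_fin !normrM ler_wpM2r//.
by rewrite (le_trans gpM)// ler_norm.
Qed.

End energies.

(** * Moments over the unit ball and monotonicity near 0 *)

Section monotonicity.
Local Open Scope ereal_scope.
Context {R : realType}.
Implicit Types (p : heis R) (r k : R).
Local Notation mu := (@heis_measure R).
Local Notation mheis :=
  (measurableTypeR R * measurableTypeR R * measurableTypeR R)%type.

(** A real-valued integral, so that A, B and C can be coefficients of a real polynomial. *)
Definition kball1_moment (g : heis R -> R) : R :=
  (\int[mu]_(p in kball 1) (g p * koranyi p ^- 2))%R.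

Lemma horizontal_sq_ge0 p : (0 <= horizontal_sq p)%R.
Proof. by rewrite addr_ge0 ?sqr_ge0. Qed.

Lemma koranyi_sq_le1 p : kball 1 p -> (koranyi p ^+ 2 <= 1)%R.
Proof.
by rewrite /kball/= => p1; rewrite expr_le1 ?koranyi_ge0// ltW.
Qed.

Lemma horizontal_sq_le1 p : kball 1 p -> (`|horizontal_sq p| <= 1)%R.
Proof.
move=> /koranyi_sq_le1 p1; rewrite ger0_norm ?horizontal_sq_ge0//.
exact: le_trans (sq_horizontal_le_koranyi p) p1.
Qed.

Lemma quartic_part_ge0 p : (0 <= quartic_part p)%R.
Proof. by rewrite addr_ge0 ?sqr_ge0// mulr_ge0 ?sqr_ge0. Qed.

(** The constant is 36 + 9^2, with 9 a crude bound: |6xy| <= 3 and |3t| <= 3 on the unit ball. *)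
Lemma quartic_part_bound p : kball 1 p -> (`|quartic_part p| <= 117)%R.
Proof.
move=> p1; rewrite ger0_norm ?quartic_part_ge0//.
have := horizontal_sq_le1 p1; rewrite ger0_norm ?horizontal_sq_ge0// => h1.
have h0 := horizontal_sq_ge0 p.
have := le_trans (vertical_le_koranyi p) (koranyi_sq_le1 p1).
rewrite ler_norml => /andP[t1 t2]; rewrite /quartic_part.
rewrite -/(horizontal_sq p).
set x := xcoord p; set y := ycoord p.
have h2 : (horizontal_sq p ^+ 2 <= 1)%R by rewrite expr_le1.
have xy1 : (- 1 <= 2 * (x * y) <= 1)%R.
  have h : (x ^+ 2 + y ^+ 2 <= 1)%R := h1.
  have := sqr_ge0 (x + y); have := sqr_ge0 (x - y); move=> *.
  by apply/andP; split; lra.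
have : ((6 * (x * y) - 3 * tcoord p) ^+ 2 <= 9 ^+ 2)%R.
  rewrite -[leLHS]real_normK ?num_real// lerXn2r ?nnegrE//.
  by rewrite ler_norml; move: xy1 => /andP[a b]; apply/andP; split; lra.
lra.
Qed.

Lemma integrable_kball1_1 :
  mu.-integrable (kball 1) (EFin \o (fun p => cst 1 p * koranyi p ^- 2)%R).
Proof.
by apply: (@integrable_bounded_koranyi_sqV _ _ 1) => // p _; rewrite normr1.
Qed.

Lemma integrable_kball1_horizontal_sq :
  mu.-integrable (kball 1) (EFin \o (fun p => horizontal_sq p * koranyi p ^- 2)%R).
Proof.
apply: (@integrable_bounded_koranyi_sqV _ _ 1).
  exact: measurable_horizontal_sq.
by move=> p; exact: horizontal_sq_le1.
Qed.

Lemma integrable_kball1_quartic_part :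
  mu.-integrable (kball 1) (EFin \o (fun p => quartic_part p * koranyi p ^- 2)%R).
Proof.
apply: (@integrable_bounded_koranyi_sqV _ _ 117).
  exact: measurable_quartic_part.
by move=> p; exact: quartic_part_bound.
Qed.

Lemma kball1_moment_ge0 (g : heis R -> R) :
  (forall p, (0 <= g p)%R) -> (0 <= kball1_moment g)%R.
Proof.
by move=> g0; apply: Rintegral_ge0 => p _; rewrite mulr_ge0 ?koranyi_exprN2_ge0.
Qed.

(** The fourth power of the norm is at most (1/4 + 1/4)^2 + 1/4 = 1/2 on the cube. *)
Lemma heis_box_sub_kball1 : heis_box 4^-1 2^-1 `<=` @kball R 1.
Proof.
move=> p; rewrite /heis_box/= !in_itv/= => -[[/andP[x1 x2] /andP[y1 y2]] /andP[t1 t2]].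
rewrite /kball/= -(@ltr_pXn2r _ 4)// ?nnegrE ?koranyi_ge0// koranyi_pow4 expr1n.
rewrite /xcoord /ycoord /tcoord.
have x3 : (p.1.1 ^+ 2 <= 4^-1)%R by nra.
have y3 : (p.1.2 ^+ 2 <= 4^-1)%R by nra.
have t3 : (p.2 ^+ 2 <= 4^-1)%R by nra.
have := sqr_ge0 p.1.1; have := sqr_ge0 p.1.2; nra.
Qed.

(** On a cube of side 1/4 inside the unit ball, x^2 + y^2 is at least 2/16 = 1/8 and the weight at
    least 1. *)
Lemma kball1_moment_horizontal_sq_gt0 : (0 < kball1_moment horizontal_sq)%R.
Proof.
have mB := measurable_heis_box (4^-1 : R) 2^-1.
have mK := measurable_kball (1 : R).
rewrite -lte_fin /kball1_moment /Rintegral fineK; last first.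
  exact: (integrable_fin_num mK integrable_kball1_horizontal_sq).
apply: (@lt_le_trans _ _ (\int[mu]_(p in heis_box 4^-1 2^-1) (cst 8^-1%:E p))).
  rewrite integral_cst//.
  have boxE := @heis_measure_box R 4^-1 2^-1 ltac:(lra).
  rewrite (_ : _ * _ = (8^-1)%:E * ((2^-1 - 4^-1) ^+ 3)%:E); last first.
    by congr (_ * _); exact: boxE.
  by rewrite -EFinM lte_fin mulr_gt0 ?invr_gt0// exprn_gt0//; lra.
have mw := measurable_int mu integrable_kball1_horizontal_sq.
have w0 p : 0 <= (horizontal_sq p * koranyi p ^- 2)%:E.
  by rewrite lee_fin mulr_ge0 ?horizontal_sq_ge0 ?koranyi_exprN2_ge0.
apply: (@le_trans _ _ (\int[mu]_(p in heis_box 4^-1 2^-1)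
    (horizontal_sq p * koranyi p ^- 2)%:E)); last first.
  exact: (ge0_subset_integral mu mB mK mw (fun p _ => w0 p) heis_box_sub_kball1).
have mw' := measurable_funS mK heis_box_sub_kball1 mw.
apply: ge0_le_integral; first exact: mB.
- by move=> p _; rewrite lee_fin.
- exact: measurable_cst.
- exact: mw'.
- move=> p pB; rewrite lee_fin.
  have := heis_box_sub_kball1 pB.
  move=> /koranyi_sq_le1 k1.
  move: pB; rewrite /heis_box/= !in_itv/= => -[[/andP[x1 x2] /andP[y1 y2]] /andP[t1 t2]].
  have h8 : (8^-1 <= horizontal_sq p)%R.
    by rewrite /horizontal_sq /xcoord /ycoord; nra.
  have kgt0 : (0 < koranyi p ^+ 2)%R.
    by apply: lt_le_trans (sq_horizontal_le_koranyi p); apply: lt_le_trans h8; lra.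
  by rewrite (le_trans h8)// ler_peMr ?horizontal_sq_ge0// invf_ge1.
Qed.

Local Notation A := (kball1_moment (cst 1%R)).
Local Notation B := (kball1_moment horizontal_sq).
Local Notation C := (kball1_moment quartic_part).

Lemma integral_kball1_combination (c a b : R) :
  \int[mu]_(p in kball 1)
    ((c + a * horizontal_sq p + b * quartic_part p) * koranyi p ^- 2)%:E =
  (c * A + a * B + b * C)%:E.
Proof.
have mK := measurable_kball (1 : R).
have iA := integrable_kball1_1.
have iB := integrable_kball1_horizontal_sq.
have iC := integrable_kball1_quartic_part.
have cA := integrableZl mK c iA.
have aB := integrableZl mK a iB.
have bC := integrableZl mK b iC.
transitivity (\int[mu]_(p in kball 1)
  (c%:E * (cst 1 p * koranyi p ^- 2)%:E +
   a%:E * (horizontal_sq p * koranyi p ^- 2)%:E +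
   b%:E * (quartic_part p * koranyi p ^- 2)%:E)).
  apply: eq_integral => p _.
  by rewrite -!EFinM -!EFinD /=; congr (_%:E); ring.
rewrite (integralD mK (integrableD mK cA aB) bC) (integralD mK cA aB).
rewrite (integralZl mK iA) (integralZl mK iB) (integralZl mK iC).
rewrite /kball1_moment /Rintegral !EFinD !EFinM !fineK//.
- exact: (integrable_fin_num mK iC).
- exact: (integrable_fin_num mK iB).
- exact: (integrable_fin_num mK iA).
Qed.

(** The function P: the energy of [heis_u] on the ball of radius [r], divided by r^2. *)
Definition acf_profile r : R := (A - 12 * B * r ^+ 2 + C * r ^+ 4)%R.

Lemma integral_density_kball r : (0 < r)%R ->
  \int[mu]_(p in kball r) density p = (r ^+ 2 * acf_profile r)%:E.
Proof.
move=> r0; have rn0 : r != 0%R by rewrite gt_eqF.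
have rn2 : (r ^+ 2)%R != 0%R by rewrite expf_neq0.
(* The weight contributes r^(-2), which lowers the coefficients 1, -12 r^2, r^4 by two degrees; the
   Jacobian r^4 then gives r^2 P(r). *)
have dilE p : density (heis_diag r r (r ^+ 2) p) =
    ((r ^- 2 + - 12 * horizontal_sq p + r ^+ 2 * quartic_part p) *
     koranyi p ^- 2)%:E.
  rewrite /density heis_u_grad_sq_dilation koranyi_dilation ?(ltW r0)//.
  by rewrite exprMn invfM mulrA; congr ((_ * _)%:E); field.
rewrite (ge0_integral_heis_diag rn0 rn0 rn2 (measurable_kball _)
  (@measurable_density _ _) (fun p _ => density_ge0 p)).
rewrite preimage_dilation_kball// mulVf//.
under eq_integral do rewrite dilE.
rewrite integral_kball1_combination -EFinM /acf_profile; congr (_%:E).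
by rewrite !gtr0_norm ?exprn_gt0//; field.
Qed.

Lemma integral_pos_density_kball r : (0 < r)%R ->
  \int[mu]_(p in kball r) pos_density p = (r ^+ 2 * acf_profile r / 2)%:E.
Proof.
move=> r0; have := integral_density_kball r0; rewrite integral_density.
have : 0 <= \int[mu]_(p in kball r) pos_density p.
  by apply: integral_ge0 => p _; exact: pos_density_ge0.
(* Infinite values contradict the finite sum or the sign, so halving takes place among real
   numbers. *)
case: (\int[mu]_(p in kball r) pos_density p) => [e| |]//= _.
by rewrite -EFinD => -[<-]; congr (_%:E); field.
Qed.

(** Read off from the energy r^2 P(r), without estimates of A, B, C. *)
Lemma acf_profile_ge0 r : (0 < r)%R -> (0 <= acf_profile r)%R.
Proof.
move=> r0; have : 0 <= \int[mu]_(p in kball r) density p.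
  by apply: integral_ge0 => p _; exact: density_ge0.
by rewrite integral_density_kball// lee_fin pmulr_rge0// exprn_gt0.
Qed.

(** The two energies are alpha_i^2 r^2 P(r) / 2, and r^(-4) cancels the powers of r. *)
Lemma acf_two_phase_heis_u (a1 a2 r : R) : (0 < a1)%R -> (0 < a2)%R -> (0 < r)%R ->
  acf (two_phase a1 a2 (@heis_u R)) r =
  ((a1 * a2 / 2) ^+ 2 * acf_profile r ^+ 2)%:E.
Proof.
move=> a10 a20 r0; rewrite acf_two_phase//.
rewrite acf_energy_funrpos_heis_u acf_energy_funrneg_heis_u.
rewrite integral_neg_density integral_pos_density_kball//.
rewrite -!EFinM; congr (_%:E); field.
by rewrite gt_eqF.
Qed.

(** The difference P(r) - P(s) has the factors s^2 - r^2 and 12 B - C (s^2 + r^2). The threshold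
    forces s < 1 and C s < 6 B, so C r^2 <= C s^2 < 6 B. *)
Lemma acf_profile_decreasing r s : (0 < r)%R -> (r < s)%R ->
  (s < 6 * B / (6 * B + C + 1))%R -> (acf_profile s < acf_profile r)%R.
Proof.
have B0 := kball1_moment_horizontal_sq_gt0.
have C0 : (0 <= C)%R by apply: kball1_moment_ge0; exact: quartic_part_ge0.
move=> r0 rs; rewrite ltr_pdivlMr; last by lra.
move=> sB; have s0 : (0 < s)%R := lt_trans r0 rs.
have s1 : (s < 1)%R by nra.
have r2s2 : (r ^+ 2 < s ^+ 2)%R by rewrite ltr_pXn2r// nnegrE ltW.
have s2 : (s ^+ 2 <= s)%R by nra.
have Cs : (C * s ^+ 2 < 6 * B)%R by nra.
rewrite -subr_gt0 /acf_profile.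
rewrite (_ : _ - _ = (s ^+ 2 - r ^+ 2) * (12 * B - C * s ^+ 2 - C * r ^+ 2))%R; last by ring.
rewrite mulr_gt0 ?subr_gt0//.
have : (C * r ^+ 2 <= C * s ^+ 2)%R by rewrite ler_wpM2l// ltW.
lra.
Qed.

End monotonicity.

Theorem mainTheorem3 (R : realType) (alpha1 alpha2 : R)
    (halpha1 : 0 < alpha1) (halpha2 : 0 < alpha2) :
  exists2 r0 : R, 0 < r0 &
    forall r s : R, 0 < r -> r < s -> s < r0 ->
      (acf (two_phase alpha1 alpha2 (@heis_u R)) s
        < acf (two_phase alpha1 alpha2 (@heis_u R)) r)%E.
Proof.
have B0 := @kball1_moment_horizontal_sq_gt0 R.
have C0 : 0 <= kball1_moment (@quartic_part R).
  by apply: kball1_moment_ge0; exact: quartic_part_ge0.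
(* The threshold of [acf_profile_decreasing]. *)
exists (6 * kball1_moment (@horizontal_sq R) /
  (6 * kball1_moment (@horizontal_sq R) + kball1_moment (@quartic_part R) + 1)).
  by apply: divr_gt0; lra.
move=> r s r0 rs sr0; have s0 := lt_trans r0 rs.
rewrite !acf_two_phase_heis_u// lte_fin ltr_pM2l; last first.
  by rewrite exprn_gt0// divr_gt0// mulr_gt0.
have [Pr Ps] := (acf_profile_ge0 r0, acf_profile_ge0 s0).
(* Squaring preserves strict inequalities between the nonnegative values of P. *)
by rewrite ltr_pXn2r// acf_profile_decreasing.
Qed.
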